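(* Let $\kappa$ be a regular infinite cardinal and $\mu$ a singular cardinal with $\mathrm{cf}(\mu)=\kappa$. (1) If $\nu=\mu^{<\kappa}$, then $\mathfrak d({}^{\nu}\kappa,\le_{\mathrm{all}})\le\mathrm{cof}(\mathcal M_\kappa({}^{\kappa}\mu,\kappa))$. (2) If $\nu=\mu^{<\mu}$, then $\mathfrak d({}^{\nu}\kappa,\le_{\mathrm{all}})\le\mathrm{cof}(\mathcal M_\kappa({}^{\mu}\mu,\mathrm{bd}))$.
   Context: For ordinals $\delta,\rho$, ${}^{\delta}\rho$ is the set of functions $\delta\to\rho$; for a partial function $s\colon\delta\rightharpoonup\rho$, $[s]=\{f\in{}^{\delta}\rho: s\subseteq f\}$. The bounded topology $\mathrm{bd}$ on ${}^{\delta}\rho$ has base $\{[s]: s\in{}^{\alpha}\rho,\ \alpha<\delta\}$; on ${}^{\kappa}\mu$ it coincides with the ${<}\kappa$-box topology (base $[s]$, $|\mathrm{dom}(s)|<\kappa$), denoted $\kappa$. A set is $\kappa$-meagre if it is a union of at most $\kappa$ nowhere dense sets; $\mathcal M_\kappa(X,\tau)$ is the ideal of $\kappa$-meagre subsets; $\mathrm{cof}(\mathcal I)$ is the least size of $F\subseteq\mathcal I$ such that every $I\in\mathcal I$ is contained in some $J\in F$. For $f,g\in{}^{\nu}\kappa$, $f\le_{\mathrm{all}}g$ means $f(\gamma)\le g(\gamma)$ for all $\gamma<\nu$, and $\mathfrak d({}^{\nu}\kappa,\le_{\mathrm{all}})$ is the least size of $D\subseteq{}^{\nu}\kappa$ such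 that every $f\in{}^{\nu}\kappa$ has some $g\in D$ with $f\le_{\mathrm{all}}g$. *)

(* Defs.v *)
From mathcomp Require Import all_boot.
From mathcomp Require Import boolp classical_sets cardinality.
Set Implicit Arguments. Unset Strict Implicit. Unset Printing Implicit Defensive.
Local Open Scope classical_set_scope.
Local Open Scope card_scope.

Definition card_lt T U (A : set T) (B : set U) : Prop :=
  (A #<= B) /\ ~ (B #<= A).

(* Ordinals / cardinals.  An infinite cardinal is represented by a type *)
(* carrying a strict well-order whose order type is an initial ordinal. *)
Definition strict_wellorder T (lt : T -> T -> Prop) : Prop :=
  [/\ (forall x, ~ lt x x),
      (forall x y z, lt x y -> lt y z -> lt x z),
      (forall x y, lt x y \/ x = y \/ lt y x)
    & well_founded lt].

Definition segment T (lt : T -> T -> Prop) (a : T) : set T := [set b | lt b a].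

Definition is_cardinal T (lt : T -> T -> Prop) : Prop :=
  strict_wellorder lt /\
  forall a : T, card_lt (segment lt a) [set: T].

Definition cofinal_in T (lt : T -> T -> Prop) (S : set T) : Prop :=
  forall a : T, exists2 b, S b & (b = a \/ lt a b).

Definition regular_infinite_cardinal T (lt : T -> T -> Prop) : Prop :=
  [/\ is_cardinal lt, infinite_set [set: T]
    & forall S : set T, cofinal_in lt S -> [set: T] #<= S].

Definition cofinality_is T (lt : T -> T -> Prop) K (Kset : set K) : Prop :=
  (exists2 S : set T, cofinal_in lt S & S #= Kset) /\
  (forall S : set T, cofinal_in lt S -> Kset #<= S).

Definition singular_cardinal_cf T (lt : T -> T -> Prop) K : Prop :=
  [/\ is_cardinal lt, infinite_set [set: T],
      cofinality_is lt [set: K] & card_lt [set: K] [set: T]].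

(* Sequences:  ^{<delta} rho  =  union over alpha < delta of ^alpha rho *)
Definition seq_lt T (lt : T -> T -> Prop) (R : Type) : Type :=
  { a : T & ({ b : T | lt b a } -> R) }.

Section BaseTopology.
Variables (X : Type) (B : set (set X)).

Definition open_b (U : set X) : Prop :=
  forall x, U x -> exists2 b, B b & (b x /\ b `<=` U).

Definition interior_b (A : set X) : set X :=
  [set x | exists2 U, open_b U & (U x /\ U `<=` A)].

Definition closure_b (A : set X) : set X :=
  [set x | forall U, open_b U -> U x -> U `&` A !=set0].

Definition nowhere_dense_b (A : set X) : Prop :=
  interior_b (closure_b A) = set0.

Definition meagre_b K (A : set X) : Prop :=
  exists N : K -> set X, (forall i, nowhere_dense_b (N i)) /\
                         A = \bigcup_(i in [set: K]) N i.
End BaseTopology.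

Definition cofinal_family X (I : set (set X)) (F : set (set X)) : Prop :=
  F `<=` I /\ forall A, I A -> exists2 J, F J & A `<=` J.

(* basic open [s] for a partial function with domain D *)
Definition cyl X Y (D : set X) (s : X -> Y) : set (X -> Y) :=
  [set f | forall x, D x -> f x = s x].

Definition box_base K M : set (set (K -> M)) :=
  [set C | exists (D : set K) (s : K -> M),
             card_lt D [set: K] /\ C = cyl D s].

Definition bd_base M (ltM : M -> M -> Prop) : set (set (M -> M)) :=
  [set C | exists (a : M) (s : M -> M), C = cyl (segment ltM a) s].

Definition le_of T (lt : T -> T -> Prop) (x y : T) : Prop := x = y \/ lt x y.

Definition le_all N K (ltK : K -> K -> Prop) (f g : N -> K) : Prop :=
  forall c, le_of ltK (f c) (g c).

Definition dominating N K (ltK : K -> K -> Prop) (D : set (N -> K)) : Prop :=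
  forall f : N -> K, exists2 g, D g & le_all ltK f g.

(* Main.v *)
Require Import Defs.
From mathcomp Require Import all_boot.
From mathcomp Require Import boolp classical_sets functions cardinality.
Set Implicit Arguments. Unset Strict Implicit. Unset Printing Implicit Defensive.
Local Open Scope classical_set_scope.
Local Open Scope card_scope.

(** Let L be kappa or mu, with c : kappa -> L monotone and cofinal.  For
  f : nu -> kappa, let A_f be the set of all x : L -> mu which are a
  concatenation of blocks, where a block consists of a code for some n in nu,
  of arbitrary filler up to at least c (f n), and of a fixed marker.  Changing
  a marker leaves A_f, so A_f is nowhere dense.  Suppose that A_f is contained
  in a union of nowhere dense sets N_i, i < kappa.  For i < kappa and a
  bounded sequence t, let g_(i,t)(n) be an index k such that t followed by the
  code of n has an extension of length at most c k that avoids N_i.  If no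
  g_(i,t) dominated f everywhere, one could choose at each stage i some n with
  g_(i,t)(n) < f n, where t is the part of the point built so far, and append
  a block with code n that avoids N_i; after kappa stages this yields a point
  of A_f outside all N_i.  So each member of a cofinal family F contributes
  only kappa * nu functions to a dominating family.  Finally nu <= |F|: if F
  could be enumerated by nu, one point outside each member of F, chosen in
  the cylinder of its code, would give a nowhere dense set not covered by F. *)

(** * Comparison of cardinals and products of infinite sets *)

(** Injections are handled as relations, which need neither a value outside [A] nor a unique value
    on [A]. *)
Lemma card_le_relP T U (A : set T) (B : set U) :
  A #<= B <-> exists R : T -> U -> Prop,
    (forall x, A x -> exists2 y, B y & R x y) /\
    (forall x x' y, A x -> A x' -> R x y -> R x' y -> x = x').
Proof.
elim/Ppointed: U => U in B *.
  rewrite (empty_eq0 B).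
  split=> [/card_le0P ->|[R [tot _]]]; first by exists (fun _ _ => False).
  by apply/card_le0P; rewrite -subset0 => x /tot[y].
split=> [/pcard_leP/injfunPex[f fAB finj]|[R [/= tot inj]]].
  exists (fun x y => y = f x); split=> [x Ax|x x' y Ax Ax' -> e].
    by exists (f x); first exact: fAB.
  by apply: finj; rewrite ?inE.
have /choice[f fP] : forall x, exists y, A x -> B y /\ R x y.
  move=> x; have [Ax|nAx] := EM (A x); last by exists point => /nAx.
  by have [y By Rxy] := tot _ Ax; exists y.
apply/pcard_leP/injfunPex; exists f => [x /fP[]//|x y /set_mem Ax /set_mem Ay e].
have [_ Rx] := fP _ Ax; have [_ Ry] := fP _ Ay.
by apply: inj Rx _ => //; rewrite e.
Qed.

Lemma card_leTT_inj T U (f : T -> U) : injective f -> [set: T] #<= [set: U].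
Proof.
move=> finj; apply/card_le_relP; exists (fun x y => y = f x).
by split=> [x _|x x' y _ _ -> /finj //]; exists (f x).
Qed.

Lemma card_leTTP T U : [set: T] #<= [set: U] -> exists f : T -> U, injective f.
Proof.
move=> /card_le_relP[R [tot inj]].
have /choice[f fP] x : exists y, R x y by have [y _ Rxy] := tot x I; exists y.
by exists f => x y e; apply: inj (fP x) _ => //; rewrite e.
Qed.

(** By Zorn, take a maximal graph of a partial injection from [A] to [B]. If it missed a point on
    each side, these two points could be paired. *)
Lemma card_le_total T U (A : set T) (B : set U) : A #<= B \/ B #<= A.
Proof.
pose P (G : set (T * U)) := (forall x y, G (x, y) -> A x /\ B y) /\
  forall x y x' y', G (x, y) -> G (x', y') -> x = x' <-> y = y'.
have [|G [[GAB Ginj] Gmax]] := @Zorn_bigcup _ P.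
  move=> F FP tot; split=> [x y [X FX /(proj1 (FP _ FX))//]|].
  move=> x y x' y' [X FX Xxy] [Y FY Yxy].
  have [XY|YX] := tot _ _ FX FY.
    exact: (proj2 (FP _ FY)) (XY _ Xxy) Yxy.
  exact: (proj2 (FP _ FX)) Xxy (YX _ Yxy).
have [totA|ntotA] := EM (forall x, A x -> exists2 y, B y & G (x, y)).
  left; apply/card_le_relP; exists (fun x y => G (x, y)); split=> // x x' y _ _ h h'.
  by apply/(Ginj _ _ _ _ h h').
have [totB|ntotB] := EM (forall y, B y -> exists2 x, A x & G (x, y)).
  right; apply/card_le_relP; exists (fun y x => G (x, y)); split=> // y y' x _ _ h h'.
  by apply/(Ginj _ _ _ _ h h').
have /existsNP[x /not_implyP[Ax nx]] := ntotA.
have /existsNP[y /not_implyP[By ny]] := ntotB.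
exfalso; apply: (Gmax (G `|` [set (x, y)])).
  split=> [z Gz|sub]; first by left.
  by apply: nx; exists y => //; apply: sub; right.
split=> [u v [/GAB//|[-> ->]//]|u v u' v' [Guv|[-> ->]] [Guv'|[-> ->]]//].
- exact: Ginj.
- split=> e; exfalso; [apply: nx; exists v|apply: ny; exists u]; rewrite -?e //.
    by have [] := GAB _ _ Guv.
  by have [] := GAB _ _ Guv.
- split=> e; exfalso; [apply: nx; exists v'|apply: ny; exists u']; rewrite ?e //.
    by have [] := GAB _ _ Guv'.
  by have [] := GAB _ _ Guv'.
Qed.

Lemma card_le_setX T U T' U' (A : set T) (B : set U) (A' : set T') (B' : set U') :
  A #<= B -> A' #<= B' -> A `*` A' #<= B `*` B'.
Proof.
move=> /card_le_relP[R [Rtot Rinj]] /card_le_relP[R' [Rtot' Rinj']].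
apply/card_le_relP; exists (fun p q => R p.1 q.1 /\ R' p.2 q.2); split.
  move=> [x y] [/= Ax Ay].
  have [u Bu Ru] := Rtot _ Ax; have [v Bv Rv] := Rtot' _ Ay.
  by exists (u, v).
move=> [x y] [x' y'] [u v] [/= Ax Ay] [/= Ax' Ay'] [/= R1 R2] [/= R3 R4].
by rewrite (Rinj _ _ _ Ax Ax' R1 R3) (Rinj' _ _ _ Ay Ay' R2 R4).
Qed.

(* Zorn's lemma on the partial graphs of injections D * D -> D with D
   infinite; if a maximal D were smaller than T, then T minus D would contain
   a copy D' of D, and the new pairs of (D + D')^2 could be sent into D'. *)
Theorem card_sq_infinite T : infinite_set [set: T] -> [set: T * T] #<= [set: T].
Proof.
move=> /infiniteP/card_leTTP[i iinj].
have /card_eqPle[/card_leTTP[pr prinj] _] := card_nat2.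
pose G0 := [set p : T * T * T | exists a b, p = (i a, i b, i (pr (a, b)))].
pose D (G : set (T * T * T)) x := exists z, G (x, x, z).
pose sq G := [/\ forall x y z, G (x, y, z) -> [/\ D G x, D G y & D G z],
  forall x y, D G x -> D G y -> exists z, G (x, y, z) &
  forall x y x' y' z, G (x, y, z) -> G (x', y', z) -> x = x' /\ y = y'].
have DS G H : G `<=` H -> D G `<=` D H.
  by move=> GH x [z /GH Gz]; exists z.
pose P G := G = set0 \/ G0 `<=` G /\ sq G.
have DG0 n : D G0 (i n) by exists (i (pr (n, n))), n, n.
have PG0 : P G0.
  right; split=> //; split.
  - by move=> x y z [a [b [-> -> ->]]].
  - move=> x y [z [a [b [-> _ _]]]] [z' [a' [b' [-> _ _]]]].
    by exists (i (pr (a, a'))), a, a'.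
  - by move=> x y x' y' z [a [b [-> -> ->]]] [a' [b' [-> -> /iinj/prinj[-> ->]]]].
have [|G [PG Gmax]] := @Zorn_bigcup _ P.
  move=> F FP tot.
  have [[X [FX G0X]]|nF] := EM (exists X, F X /\ G0 `<=` X); last first.
    left; rewrite -subset0 => p [X FX Xp]; have [X0|[G0X _]] := FP _ FX.
      by rewrite X0 in Xp.
    by apply: nF; exists X.
  have sqF Y p : F Y -> Y p -> sq Y.
    by move=> FY Yp; case: (FP _ FY) => [Y0|[]//]; rewrite Y0 in Yp.
  have sub Y : F Y -> Y `<=` \bigcup_(X in F) X by move=> FY p Yp; exists Y.
  right; split; first by move=> p /G0X Xp; exists X.
  split.
  - move=> x y z [Y FY Yp]; have [/(_ _ _ _ Yp)[h1 h2 h3] _ _] := sqF _ _ FY Yp.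
    by split; apply: DS (sub _ FY) _ _.
  - move=> x y [z [Y FY Yp]] [z' [Y' FY' Yp']].
    have [YY|YY] := tot _ _ FY FY'.
      have [_ totY _] := sqF _ _ FY' Yp'.
      have Dx : D Y' x by exists z; apply: YY.
      have Dy : D Y' y by exists z'.
      by have [w Yw] := totY _ _ Dx Dy; exists w, Y'.
    have [_ totY _] := sqF _ _ FY Yp.
    have Dx : D Y x by exists z.
    have Dy : D Y y by exists z'; apply: YY.
    by have [w Yw] := totY _ _ Dx Dy; exists w, Y.
  - move=> x y x' y' z [Y FY Yp] [Y' FY' Yp'].
    have [YY|YY] := tot _ _ FY FY'.
      have [_ _ inj] := sqF _ _ FY' Yp'; exact: inj (YY _ Yp) Yp'.
    have [_ _ inj] := sqF _ _ FY Yp; exact: inj Yp (YY _ Yp').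
have {PG}[G0G [Gdom Gtot Ginj]] : G0 `<=` G /\ sq G.
  case: PG => // G0'; exfalso; apply: (Gmax G0); last exact: PG0.
  rewrite G0'; split=> // /(_ (i 0, i 0, i (pr (0, 0)))); apply.
  by exists 0, 0.
have Di n : D G (i n) by apply: DS G0G _ _.
have sqD : D G `*` D G #<= D G.
  apply/card_le_relP; exists (fun p z => G (p.1, p.2, z)); split.
    move=> [x y] [/= Dx Dy]; have [z Gz] := Gtot _ _ Dx Dy.
    by exists z => //; have [] := Gdom _ _ _ Gz.
  by move=> [x y] [x' y'] z _ _ /= h h'; have [-> ->] := Ginj _ _ _ _ _ h h'.
have [TD|nTD] := EM ([set: T] #<= D G).
  rewrite -setXTT; apply: card_le_trans (card_le_setX TD TD) _.
  exact: card_le_trans sqD (card_leT _).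
(* Otherwise the complement embeds in [D G], so [T] embeds in the square of [D G] with [i 0] and
   [i 1] as tags, hence in [D G]. *)
have /card_le_relP[R [Rtot Rinj]] : D G #<= ~` D G.
  have [//|/card_le_relP[R [Rtot Rinj]]] := card_le_total (D G) (~` D G).
  exfalso; apply: nTD; apply: card_le_trans sqD; apply/card_le_relP.
  exists (fun x p => (D G x /\ p = (x, i 0)) \/ (~ D G x /\ R x p.1 /\ p.2 = i 1)).
  split=> [x _|x x' [p q] _ _].
    have [Dx|nDx] := EM (D G x); first by exists (x, i 0); [split=> //; exact: Di|left].
    have [y Dy Rxy] := Rtot _ (nDx : (~` D G) x).
    by exists (y, i 1); [split=> //; exact: Di|right].
  move=> /= [[Dx [-> ->]]|[nDx [Rx ->]]] [[Dx' []]|[nDx' [Rx']]] //.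
  - by move=> /iinj.
  - by move=> _ /iinj.
  - by move=> _; exact: Rinj Rx Rx'.
have /choice[h hP] x : exists y, D G x -> ~ D G y /\ R x y.
  have [/Rtot[y Dy Rxy]|nD] := EM (D G x); last by exists x.
  by exists y.
have hinj x y : D G x -> D G y -> h x = h y -> x = y.
  move=> Dx Dy e; have [_ Rx] := hP _ Dx; have [_ Ry] := hP _ Dy.
  by apply: Rinj Rx _ => //; rewrite e.
pose E x := D G x \/ exists2 y, D G y & x = h y.
have /choice[pi piP] x : exists p : T * nat, E x ->
    D G p.1 /\ (x = p.1 /\ p.2 = 0 \/ x = h p.1 /\ p.2 = 1).
  have [Ex|nE] := EM (E x); last by exists (x, 0).
  case: Ex => [Dx|[y Dy ->]]; [exists (x, 0)|exists (y, 1)] => _; split=> //.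
    by left.
  by right.
have piinj x y : E x -> E y -> pi x = pi y -> x = y.
  move=> /piP[_ hx] /piP[_ hy] e; rewrite e in hx.
  by case: (pi y) hx hy => [q n] /= [[-> ->]|[-> ->]] [[-> ]|[-> ]].
have /choice[e eP] p : exists z, D G p.1 /\ D G p.2 -> G (p.1, p.2, z).
  have [[h1 h2]|nD] := EM (D G p.1 /\ D G p.2); last by exists p.1.
  by have [z Gz] := Gtot _ _ h1 h2; exists z.
have eD x y : D G x -> D G y -> D G (e (x, y)).
  by move=> Dx Dy; have /= [] := Gdom _ _ _ (eP (x, y) (conj Dx Dy)).
have einj x y x' y' : D G x -> D G y -> D G x' -> D G y' ->
    e (x, y) = e (x', y') -> x = x' /\ y = y'.
  move=> Dx Dy Dx' Dy' ee; apply: Ginj (eP (x, y) (conj Dx Dy)) _.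
  by rewrite ee; apply: (eP (x', y')).
(* Both components in [D G] and both tags are coded by one element of [D G]; [h] then moves it out
   of [D G], away from the values of [G]. *)
pose c u v := h (e (e ((pi u).1, (pi v).1), i (pr ((pi u).2, (pi v).2)))).
have cD u v : E u -> E v ->
    D G (e (e ((pi u).1, (pi v).1), i (pr ((pi u).2, (pi v).2)))).
  by move=> /piP[Du _] /piP[Dv _]; apply: (eD); [exact: eD|exact: Di].
have cinj u v u' v' : E u -> E v -> E u' -> E v' -> c u v = c u' v' ->
    u = u' /\ v = v'.
  move=> Eu Ev Eu' Ev' /(hinj _ _ (cD _ _ Eu Ev) (cD _ _ Eu' Ev')).
  have [Du _] := piP _ Eu; have [Dv _] := piP _ Ev.
  have [Du' _] := piP _ Eu'; have [Dv' _] := piP _ Ev'.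
  case/einj; try (exact: (Di)); try (exact: (eD)).
  move=> /einj[]// e1 e2 /iinj/prinj[e3 e4].
  by split; apply: piinj => //; [case: (pi u) (pi u') e1 e3|case: (pi v) (pi v') e2 e4];
    move=> a b [a' b'] /= -> ->.
exfalso; pose H := [set p : T * T * T | [/\ E p.1.1, E p.1.2,
  ~ (D G p.1.1 /\ D G p.1.2) & p.2 = c p.1.1 p.1.2]].
have nDh x : D G x -> ~ D G (h x) by move=> /hP[].
have DE x : D (G `|` H) x <-> E x.
  split=> [[z [Gz|[]//]]|Ex]; first by left; exists z.
  have [Dx|nDx] := EM (D G x); last by exists (c x x); right; split=> // -[].
  by apply: DS Dx; left.
apply: (Gmax (G `|` H)).
  split=> [p Gp|/(_ (h (i 0), h (i 0), c (h (i 0)) (h (i 0)))) HG].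
    by left.
  apply: (nDh (i 0)) (Di 0) _; eexists; apply: HG; right.
  have Eh : E (h (i 0)) by right; exists (i 0) => //; exact: Di.
  by split=> // -[/(nDh _ (Di 0))].
right; split; first by move=> p /G0G; left.
split.
- move=> x y z [Gz|[/= Ex Ey _ ->]].
    by have [? ? ?] := Gdom _ _ _ Gz; split; apply/DE; left.
  by split; apply/DE => //; right; eexists; first exact: cD Ex Ey.
- move=> x y /DE Ex /DE Ey.
  have [[Dx Dy]|nD] := EM (D G x /\ D G y).
    by have [z Gz] := Gtot _ _ Dx Dy; exists z; left.
  by exists (c x y); right.
- move=> x y x' y' z [Gz|[/= Ex Ey _ ->]] [Gz'|[/= Ex' Ey' _ e']].
  + exact: Ginj Gz Gz'.
  + exfalso; have [_ _] := Gdom _ _ _ Gz; rewrite e'; apply: nDh; exact: cD.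
  + exfalso; have [_ _] := Gdom _ _ _ Gz'; apply: nDh; exact: cD.
  + exact: cinj.
Qed.

Corollary card_setX_infinite T (A : set T) : infinite_set A -> A `*` A #<= A.
Proof.
move=> Ainf; have AT := card_setT A; have /card_eqPle[TA AT'] := AT.
apply: card_le_trans (card_le_setX AT' AT') _; rewrite setXTT.
by apply: card_le_trans TA; apply: card_sq_infinite; rewrite (eq_finite_set AT).
Qed.

(** View the square of [T] inside [T]. Either some row lies in [B], or every row contributes a point
    of [A]. *)
Lemma card_cover_infinite T (A B : set T) : infinite_set [set: T] ->
  (forall x, A x \/ B x) -> [set: T] #<= A \/ [set: T] #<= B.
Proof.
move=> /card_sq_infinite/card_leTTP[f finj] AB.
have [[x xB]|nB] := EM (exists x, forall y, B (f (x, y))).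
  right; apply/card_le_relP; exists (fun y z => z = f (x, y)).
  split=> [y _|y y' z _ _ -> /finj[]//]; by exists (f (x, y)).
left; apply/card_le_relP; exists (fun x z => exists y, z = f (x, y)); split=> [x _|].
  have [y nBy] : exists y, ~ B (f (x, y)) by apply/existsNP => Bx; apply: nB; exists x.
  by exists (f (x, y)); [case: (AB (f (x, y)))|exists y].
by move=> x x' z _ _ [y ->] [y' /finj[]].
Qed.

(** * Agreement on initial segments, and well-orders *)

Definition agree L (lt : L -> L -> Prop) M (a : L) (x y : L -> M) :=
  forall p, lt p a -> x p = y p.

(** Nowhere density expressed through cylinders over initial segments; see [nowhere_dense_cyl]. *)
Definition comb_nowhere_dense L (lt : L -> L -> Prop) M (A : set (L -> M)) :=
  forall a x, exists a' x', [/\ le_of lt a a', agree lt a x x' &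
    forall y, agree lt a' x' y -> ~ A y].

Section WellOrder.
Variables (L : Type) (lt : L -> L -> Prop) (wo : strict_wellorder lt).
Local Notation le := (le_of lt).

Lemma wo_irr a : ~ lt a a. Proof. by case: wo => irr _ _ _; exact: irr. Qed.

Lemma wo_trans a b d : lt a b -> lt b d -> lt a d.
Proof. by case: wo => _ tr _ _; exact: tr. Qed.

Lemma wo_le_lt a b d : le a b -> lt b d -> lt a d.
Proof. by case=> [->//|]; exact: wo_trans. Qed.

Lemma wo_lt_le a b d : lt a b -> le b d -> lt a d.
Proof. by move=> ab [<-//|]; exact: wo_trans. Qed.

Lemma wo_le_trans a b d : le a b -> le b d -> le a d.
Proof. by move=> [->//|ab] bd; right; exact: wo_lt_le bd. Qed.

Lemma wo_refl a : le a a. Proof. by left. Qed.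

Lemma wo_leNgt a b : le a b <-> ~ lt b a.
Proof.
case: wo => irr tr tot _; split=> [[->|ab /(tr _ _ _ ab)]|nba]; try exact: irr.
by case: (tot a b) => [ab|[ab|//]]; [right|left].
Qed.

Lemma wo_ltNge a b : lt a b <-> ~ le b a.
Proof. by rewrite wo_leNgt; split=> [ab //|/contrapT]. Qed.

Lemma wo_leVlt a b : le a b \/ lt b a.
Proof. by have [ba|/wo_leNgt] := EM (lt b a); [right|left]. Qed.

Lemma wo_least (P : L -> Prop) : (exists x, P x) ->
  exists x, P x /\ forall y, P y -> le x y.
Proof.
move=> [x Px]; apply: contrapT => nleast.
suff: forall x, ~ P x by move=> /(_ x).
case: wo => _ _ _ wf; move=> z; elim: (wf z) => u _ IH Pu.
by apply: nleast; exists u; split=> // y Py; apply/wo_leNgt => /IH.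
Qed.

Definition wo_max u v := if `[< lt u v >] then v else u.

Lemma wo_maxl u v : le u (wo_max u v).
Proof. by rewrite /wo_max; case: asboolP; [right|left]. Qed.

Lemma wo_maxr u v : le v (wo_max u v).
Proof. by rewrite /wo_max; case: asboolP => [_|/wo_leNgt//]; left. Qed.

Lemma agree_sym M a (x y : L -> M) : agree lt a x y -> agree lt a y x.
Proof. by move=> xy p /xy. Qed.

Lemma agree_trans M a (x y z : L -> M) :
  agree lt a x y -> agree lt a y z -> agree lt a x z.
Proof. by move=> xy yz p pa; rewrite xy// yz. Qed.

Lemma agree_le M a b (x y : L -> M) : le a b -> agree lt b x y -> agree lt a x y.
Proof. by move=> ab xy p pa; apply: xy; exact: wo_lt_le ab. Qed.

Lemma agree_glue M a (x y : L -> M) :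
  exists z, agree lt a x z /\ forall p, le a p -> z p = y p.
Proof.
exists (fun p => if `[< lt p a >] then x p else y p); split=> p; case: asboolP => //.
by move=> pa /wo_leNgt.
Qed.

End WellOrder.

(** * Construction of a point in kappa stages *)

Section Chain.
Variables (K : Type) (ltK : K -> K -> Prop) (woK : strict_wellorder ltK).
Variables (L : Type) (lt : L -> L -> Prop) (wo : strict_wellorder lt).
Local Notation le := (le_of lt).
Variables (c : K -> L) (c_cof : forall a, exists i, lt a (c i)).
Hypothesis bounded : forall (i : K) (h : K -> L),
  exists a, forall j, ltK j i -> le (h j) a.
Variables (M : Type) (m0 : M) (l0 : L).

(* Proper initial segments of K are shorter than the cofinality of L, so the
   approximations built before stage i have lengths bounded in L. *)
Lemma chain_exists (good : L -> (L -> M) -> Prop)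
    (avoid : K -> L -> (L -> M) -> Prop) :
  (forall a x y, good a x -> agree lt a x y -> good a y) ->
  (forall a x, (forall p, lt p a -> exists a', [/\ lt p a', le a' a & good a' x]) ->
     good a x) ->
  (forall i a x y, avoid i a x -> agree lt a x y -> avoid i a y) ->
  (forall i a x, good a x -> exists a' x',
     [/\ le a a', agree lt a x x', good a' x', avoid i a' x' & le (c i) a']) ->
  exists x, forall i, exists a, [/\ le (c i) a, good a x & avoid i a x].
Proof.
move=> Hloc Hlim Hav Hstep; pose node := (L * (L -> M))%type.
have [step stepP] : exists step : K -> node -> node, forall i t, good t.1 t.2 ->
    [/\ le t.1 (step i t).1, agree lt t.1 t.2 (step i t).2,
      good (step i t).1 (step i t).2, avoid i (step i t).1 (step i t).2 &
      le (c i) (step i t).1].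
  have /choice[st stP] : forall p : K * node, exists t', good p.2.1 p.2.2 ->
    [/\ le p.2.1 t'.1, agree lt p.2.1 p.2.2 t'.2,
      good t'.1 t'.2, avoid p.1 t'.1 t'.2 & le (c p.1) t'.1].
    move=> [i t] /=; have [g|ng] := EM (good t.1 t.2); last by exists t => /ng.
    by have [a' [x' h]] := Hstep i _ _ g; exists (a', x').
  by exists (fun i t => st (i, t)) => i t; exact: (stP (i, t)).
pose coherent (S : set node) := forall t t' p, S t -> S t' ->
  lt p t.1 -> lt p t'.1 -> t.2 p = t'.2 p.
(* The union of a coherent bounded family. Its length is the least upper bound, so each position
   below it is covered by some member. *)
have /choice[glue glueP] : forall S : set node, exists g : node,
    coherent S -> (exists a, forall t, S t -> le t.1 a) ->
    (forall t, S t -> le t.1 g.1 /\ agree lt t.1 t.2 g.2) /\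
    (forall p, lt p g.1 -> exists2 t, S t & lt p t.1).
  move=> S; have [[coh bd]|nS] := EM (coherent S /\ exists a, forall t, S t -> le t.1 a);
    last by exists (l0, fun=> m0) => coh bd; exfalso; apply: nS.
  have [a [ab aleast]] := wo_least wo bd.
  have /choice[x xP] p : exists m, forall t, S t -> lt p t.1 -> m = t.2 p.
    have [[t [St pt]]|nt] := EM (exists t, S t /\ lt p t.1).
      by exists (t.2 p) => t' St' pt'; exact: coh.
    by exists m0 => t St pt; exfalso; apply: nt; exists t.
  exists (a, x) => _ _; split=> [t St|p /= pa].
    by split; [exact: ab|move=> p pt; rewrite /= (xP p t)].
  apply: contrapT => nt; apply: (wo_irr wo (a := p)).
  apply: (wo_lt_le wo pa); apply: aleast => t St.
  by apply/(wo_leNgt wo) => pt; apply: nt; exists t.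
pose body i (r : forall j, ltK j i -> node) :=
  step i (glue [set t | exists j (h : ltK j i), t = r j h]).
have wfK : well_founded ltK by case: woK.
pose F := Fix wfK (fun=> node) body.
pose S i := [set t | exists2 j, ltK j i & t = F j].
have FE i : F i = step i (glue (S i)).
  rewrite /F Fix_eq /body; last first.
    move=> {}i f g fg; suff -> : f = g by [].
    by apply: functional_extensionality_dep => j; apply/funext => h.
  congr (step _ (glue _)); apply/seteqP; split=> t.
    by move=> [j [h ->]]; exists j.
  by move=> [j h ->]; exists j, h.
have cohF (J : set K) : (forall i j, J i -> J j -> ltK j i ->
    le (F j).1 (F i).1 /\ agree lt (F j).1 (F j).2 (F i).2) ->
  forall i j p, J i -> J j -> lt p (F i).1 -> lt p (F j).1 -> (F i).2 p = (F j).2 p.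
  move=> H i j p Ji Jj pi pj; case: woK => _ _ /(_ i j) tot _.
  case: tot => [ij|[->//|ji]].
    by have [_ ->] := H _ _ Jj Ji ij.
  by have [_ ->] := H _ _ Ji Jj ji.
have inv i : [/\ good (F i).1 (F i).2, avoid i (F i).1 (F i).2, le (c i) (F i).1 &
    forall j, ltK j i -> le (F j).1 (F i).1 /\ agree lt (F j).1 (F j).2 (F i).2].
  elim: (wfK i) => {}i _ IH.
  have cohS : coherent (S i).
    move=> _ _ p [j ji ->] [k ki ->]; apply: (cohF [set j | ltK j i]) => //.
    by move=> u v /= ui _; have [_ _ _] := IH _ ui; apply.
  have bdS : exists a, forall t, S i t -> le t.1 a.
    have [a aP] := bounded i (fun j => (F j).1).
    by exists a => _ [j ji ->]; exact: aP.
  have [g1 g2] := glueP _ cohS bdS.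
  (* First, successor and limit stages are all covered by [Hlim]: at the first it is vacuous, and
     after a last stage [a'] may equal the length itself. *)
  have goodg : good (glue (S i)).1 (glue (S i)).2.
    apply: Hlim => p /g2[_ [j ji ->] pj]; exists (F j).1.
    have [|h1 h2] := g1 (F j); first by exists j.
    by split=> //; apply: Hloc h2; have [] := IH _ ji.
  rewrite FE; have [h1 h2 h3 h4 h5] := stepP i _ goodg; split=> // j ji.
  have [|h6 h7] := g1 (F j); first by exists j.
  split; first exact: wo_le_trans h1.
  by apply: agree_trans h7 _; apply: agree_le h2.
(* The value at [p] is read at a stage [k p] whose length exceeds [p]. *)
have /choice[k kP] := c_cof.
exists (fun p => (F (k p)).2 p) => i; have [h1 h2 h3 h4] := inv i.
have ag : agree lt (F i).1 (F i).2 (fun p => (F (k p)).2 p).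
  move=> p pi; apply: (cohF setT) => //.
    by move=> u v _ _; have [_ _ _] := inv u; apply.
  by apply: wo_lt_le (kP p) _ => //; have [] := inv (k p).
by exists (F i).1; split=> //; [apply: Hloc ag|apply: Hav ag].
Qed.
End Chain.

(** * The coded sets: nowhere density and decoding *)

Section Coding.
Variables (K : Type) (ltK : K -> K -> Prop) (woK : strict_wellorder ltK).
Variables (L : Type) (lt : L -> L -> Prop) (wo : strict_wellorder lt).
Local Notation le := (le_of lt).
Local Notation lttr := (wo_trans wo).
Local Notation letr := (wo_le_trans wo).
Local Notation lelt := (wo_le_lt wo).
Local Notation ltle := (wo_lt_le wo).
Local Notation leVlt := (wo_leVlt wo).
Local Notation maxl := (@wo_maxl L lt).
Local Notation maxr := (wo_maxr wo).
Local Notation agle := (agree_le wo).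
Variables (c : K -> L) (c_cof : forall a, exists i, lt a (c i)).
Hypothesis c_mono : forall i j, ltK i j -> le (c i) (c j).
Hypothesis bounded : forall (i : K) (h : K -> L),
  exists a, forall j, ltK j i -> le (h j) a.
Variables (M : Type) (m0 m1 : M) (m01 : m0 <> m1) (l0 : L).
Variables (N : Type) (code : L -> N -> (L -> M) -> Prop) (b : L -> N -> L).
Hypothesis b_gt : forall a n, lt a (b a n).
Hypothesis code_loc : forall a n x y,
  code a n x -> agree lt (b a n) x y -> code a n y.
Hypothesis code_uniq : forall a n n' x, code a n x -> code a n' x -> n = n'.
Hypothesis code_ex : forall a n x, exists y, agree lt a x y /\ code a n y.
Variables (s : L -> L) (s_gt : forall a, lt a (s a)).
Hypothesis s_le : forall a p, lt p (s a) -> le p a.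

Definition block_end (f : N -> K) a n := wo_max lt (b a n) (c (f n)).

Lemma block_end_gt f a n : lt a (block_end f a n).
Proof. exact: ltle (b_gt a n) (maxl _ _). Qed.

Lemma s_block_gt f a n : lt a (s (block_end f a n)).
Proof. exact: lttr (block_end_gt f a n) _. Qed.

(* Positions where a block of x begins, a block being a code n followed by
   filler up to block_end f a n, where a marker is expected. *)
Inductive block_start (f : N -> K) (x : L -> M) : L -> Prop :=
| block_start_succ a n : block_start f x a -> code a n x ->
    block_start f x (s (block_end f a n))
| block_start_lim a (g : L -> L) : (forall p, lt p a -> block_start f x (g p)) ->
    (forall p, lt p a -> lt p (g p) /\ lt (g p) a) -> block_start f x a.

Definition coded_set (f : N -> K) : set (L -> M) :=
  [set x | forall a, block_start f x a ->
     exists n, code a n x /\ x (block_end f a n) = m0].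

(** The constructor takes the witnesses as a function so that induction reaches each of them; choice
    supplies it. The least position starts a block vacuously. *)
Lemma block_start_limP f x a :
  (forall p, lt p a -> exists q, [/\ lt p q, lt q a & block_start f x q]) ->
  block_start f x a.
Proof.
move=> H; have /choice[g gP] p :
    exists q, lt p a -> [/\ lt p q, lt q a & block_start f x q].
  have [pa|npa] := EM (lt p a); last by exists p.
  by have [q h] := H _ pa; exists q.
by apply: (@block_start_lim _ _ _ g) => p /gP[].
Qed.

Lemma block_start_agree f x y a :
  block_start f x a -> agree lt a x y -> block_start f y a.
Proof.
move=> ax; elim: ax y => {a} [a n _ IH cx|a g _ IH gP] y xy.
  apply: block_start_succ.
    by apply: IH; apply: agle xy => //; right; exact: s_block_gt.
  apply: code_loc cx _; apply: agle xy => //; right.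
  exact: (lelt (maxl _ _) (s_gt _)).
apply: block_start_limP => p pa; have [h1 h2] := gP _ pa; exists (g p); split=> //.
by apply: IH => //; apply: agle xy => //; right.
Qed.

(** If block starts were bounded, their least strict upper bound would be a limit of block starts,
    hence a block start below itself. *)
Lemma block_start_unbounded f x a : coded_set f x ->
  exists2 p, block_start f x p & le a p.
Proof.
move=> xA; apply: contrapT => np.
have [|u [uub uleast]] := wo_least wo
    (P := fun u => forall p, block_start f x p -> lt p u).
  by exists a => p bp; apply/(wo_ltNge wo) => ap; apply: np; exists p.
suff /uub/(wo_irr wo) : block_start f x u by [].
apply: block_start_limP => p pu.
have [q bq pq] : exists2 q, block_start f x q & le p q.
  apply: contrapT => nq; apply: (wo_irr wo (a := p)); apply: (ltle pu).
  by apply: uleast => q bq; apply/(wo_ltNge wo) => pq; apply: nq; exists q.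
have [n [cn _]] := xA _ bq; exists (s (block_end f q n)).
have bs := block_start_succ bq cn; split=> //; last exact: uub.
exact: lelt pq (s_block_gt _ _ _).
Qed.

Lemma coded_set_nowhere_dense f : comb_nowhere_dense lt (coded_set f).
Proof.
move=> a x; have [[z xz zA]|nz] := EM (exists2 z, agree lt a x z & coded_set f z);
  last first.
  exists a, x; split=> //; first exact: wo_refl.
  by move=> y xy yA; apply: nz; exists y.
have [p bp ap] := block_start_unbounded a zA; have [n _] := zA _ bp.
have [y [zy cy]] := code_ex p n z; pose e := block_end f p n.
(* In any point that agrees with [w] up to and including [e], a block with code [n] still starts at
   [p], but its marker is [m1] instead of [m0]. *)
have [w [yw wm]] := agree_glue wo e y (fun=> m1).
have pe : lt p e by exact: block_end_gt.
have zw : agree lt p z w by apply: agree_trans zy _; apply: agle yw => //; right.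
have cw : code p n w.
  by apply: code_loc cy _; apply: agle yw => //; exact: maxl.
exists (s e), w; split.
- by apply: letr ap _ => //; right; exact: s_block_gt.
- by apply: agree_trans xz _; apply: agle zw.
move=> v wv vA.
have bv : block_start f v p.
  apply: block_start_agree bp _; apply: agree_trans zw _.
  by apply: agle wv => //; right; exact: s_block_gt.
have cv : code p n v.
  apply: code_loc cw _; apply: agle wv => //; right.
  exact: (lelt (maxl _ _) (s_gt _)).
have [n' [cv' vm]] := vA _ bv; rewrite -(code_uniq cv cv') in vm.
by apply: m01; rewrite -vm -wv ?wm//; left.
Qed.

Definition good_prefix f a x := block_start f x a /\
  forall p, lt p a -> block_start f x p ->
    exists n, [/\ code p n x, x (block_end f p n) = m0 & lt (block_end f p n) a].

Lemma good_prefix_agree f a x y :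
  good_prefix f a x -> agree lt a x y -> good_prefix f a y.
Proof.
move=> [ba H] xy; split=> [|p pa bp]; first exact: block_start_agree xy.
have [|n [cn mn en]] := H p pa.
  by apply: block_start_agree bp _; apply: agree_sym; apply: agle xy => //; right.
exists n; split=> //; last by rewrite -xy.
apply: code_loc cn _; apply: agle xy => //; right.
exact: lelt (maxl _ _) en.
Qed.

Lemma good_prefix_lim f a x :
  (forall p, lt p a -> exists a', [/\ lt p a', le a' a & good_prefix f a' x]) ->
  good_prefix f a x.
Proof.
move=> H; split=> [|p pa bp].
  have [[a' [-> [//]]]|na] := EM (exists a', a' = a /\ good_prefix f a' x).
  apply: block_start_limP => p /H[a' [pa' [e|a'a] [h1 h2]]].
    by exfalso; apply: na; exists a'.
  by exists a'.
have [a' [pa' a'a [_ /(_ p pa' bp)[n [h1 h2 h3]]]]] := H _ pa.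
by exists n; split=> //; exact: ltle a'a.
Qed.

(** The point is that no block starts strictly between [a] and the end of the new block: blocks
    started before [a] end before [a], and a limit inside this gap would have starts inside it
    too. *)
Lemma good_prefix_succ f a x n : good_prefix f a x -> code a n x ->
  x (block_end f a n) = m0 -> good_prefix f (s (block_end f a n)) x.
Proof.
move=> [ba H] cn mn; split; first exact: block_start_succ.
suff gap p : block_start f x p -> le p a \/ le (s (block_end f a n)) p.
  move=> p ps bp; have [[->|pa]|] := gap _ bp; first by exists n; split.
    have [k [h1 h2 h3]] := H _ pa bp; exists k; split=> //.
    exact: lttr h3 (s_block_gt _ _ _).
  by move/(wo_leNgt wo).
elim=> {p} [q k bq IH ck|q g _ IH gP].
  case: IH => [[qa|qa]|sq].
  - by right; left; move: ck; rewrite qa => /(code_uniq cn) ->.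
  - have [k' [ck' _ h]] := H _ qa bq; left.
    by rewrite (code_uniq ck ck'); apply/(wo_leNgt wo) => /s_le/(wo_leNgt wo).
  - by right; right; exact: lelt sq (s_block_gt _ _ _).
have [|aq] := leVlt q a; [by left|right].
apply/(wo_leNgt wo) => qs; have [h1 h2] := gP _ aq.
case: (IH _ aq) => /(wo_leNgt wo); apply=> //.
exact: (lttr h2).
Qed.

(** The index [k] is a possible value of g_(i,t)(n), for t the restriction of [x] below [a].
    Reaching [c i] makes the lengths cofinal over the stages. *)
Definition bound_spec (A : K -> set (L -> M)) i a x n k := exists a' x',
  [/\ agree lt a x x', code a n x', le (c i) a', le a' (c k) &
      le (b a n) a' /\ forall y, agree lt a' x' y -> ~ A i y].

Lemma bound_spec_ex A i a x n : comb_nowhere_dense lt (A i) ->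
  exists k, bound_spec A i a x n k.
Proof.
move=> nd; have [y [xy cy]] := code_ex a n x.
have [a' [x' [h1 h2 h3]]] := nd (wo_max lt (b a n) (c i)) y.
have [k kP] := c_cof a'.
have ba' : le (b a n) a' := letr (maxl _ _) h1.
exists k, a', x'; split=> //; last by right.
- apply: agree_trans xy _; apply: agle h2 => //; right.
  exact: ltle (b_gt a n) (maxl _ _).
- by apply: code_loc cy _; apply: agle h2 => //; exact: maxl.
- exact: letr (maxr _ _) h1.
Qed.

(** This lets the bounds be indexed by bounded sequences instead of whole points, as the final count
    requires. *)
Lemma bound_spec_agree A i a x y n k : agree lt a x y ->
  bound_spec A i a x n k -> bound_spec A i a y n k.
Proof.
move=> xy [a' [x' [h1 h2 h3 h4 h5]]]; exists a', x'; split=> //.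
by apply: agree_trans h1; exact: agree_sym.
Qed.

(* If every g i a were exceeded by f somewhere, one could build a point of
   coded_set f outside each A i, using at stage i a block whose code n
   satisfies g i a n < f n: the block is then long enough to leave A i. *)
Theorem coded_set_decode (A : K -> set (L -> M)) f (g : K -> L -> (L -> M) -> N -> K) :
  (forall i a x n, bound_spec A i a x n (g i a x n)) ->
  coded_set f `<=` \bigcup_i A i ->
  exists i a x, le_all ltK f (g i a x).
Proof.
move=> gP fA; apply: contrapT => ndom.
have {}ndom i a x : exists n, ltK (g i a x n) (f n).
  apply: contrapT => nn; apply: ndom; exists i, a, x => n.
  by apply/(wo_leNgt woK) => h; apply: nn; exists n.
have [|||x xP] := chain_exists woK wo c_cof bounded m0 l0 (good := good_prefix f)
    (avoid := fun i a x => forall y, agree lt a x y -> ~ A i y) _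
    (good_prefix_lim (f := f)).
- by move=> a x y; exact: good_prefix_agree.
- by move=> i a x y H xy z yz; apply: H; exact: agree_trans yz.
- move=> i a x ga; have [n gn] := ndom i a x.
  have [a' [x' [h1 h2 h3 h4 [h5 h6]]]] := gP i a x n; pose e := block_end f a n.
  (* Here g < f is used: a' <= c (g i a x n) <= c (f n) <= e, so the filler has room for the
     extension that avoids [A i]. *)
  have a'e : le a' e.
    apply: letr h4 _ => //; apply: letr (c_mono gn) _ => //.
    exact: maxr.
  have [w [xw wm]] := agree_glue wo e x' (fun=> m0).
  have cw : code a n w.
    by apply: code_loc h2 _; apply: agle xw => //; exact: maxl.
  have ae : lt a e by exact: block_end_gt.
  have aw : agree lt a x w.
    by apply: agree_trans h1 _; apply: agle xw => //; right.
  have es : le e (s e) by right.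
  exists (s e), w; split=> //; first by right; exact: lttr (s_gt _).
  + apply: good_prefix_succ => //; first exact: good_prefix_agree aw.
    by apply: wm; left.
  + move=> y wy; apply: h6; apply: agle a'e _ => //.
    by apply: agree_trans xw _; apply: agle wy.
  + by apply: letr h3 _ => //; exact: letr es.
(* A good prefix longer than [a] already contains the whole block that starts at [a]. *)
have xA : coded_set f x.
  move=> a ba; have [i ai] := c_cof a; have [a' [ia' [_ H] _]] := xP i.
  by have [|n [h1 h2 h3]] := H a _ ba; [exact: ltle ia'|exists n].
have [i _ Aix] := fA _ xA; have [a [_ _ /(_ x)]] := xP i; exact.
Qed.

(** The Baire category argument: stage [i] leaves [A i], while [good] only preserves agreement with
    [x] below [a]. *)
Lemma baire_cylinder (A : K -> set (L -> M)) a x :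
  (forall i, comb_nowhere_dense lt (A i)) ->
  exists2 y, agree lt a x y & ~ (\bigcup_i A i) y.
Proof.
move=> nd.
have [||||y yP] := chain_exists woK wo c_cof bounded m0 l0
    (good := fun a' y => forall p, lt p a -> lt p a' -> x p = y p)
    (avoid := fun i a' y => forall z, agree lt a' y z -> ~ A i z).
- by move=> a' y z H yz p pa pa'; rewrite H// yz.
- move=> a' y H p pa pa'.
  by have [a'' [h1 h2 h3]] := H _ pa'; exact: h3.
- by move=> i a' y z H yz w zw; apply: H; exact: agree_trans zw.
- move=> i a' y H; have [w [xw wy]] := agree_glue wo a x y.
  have yw : agree lt a' y w.
    move=> p pa'; have [ap|pa] := leVlt a p; first by rewrite wy.
    by rewrite -H// xw.
  have [a'' [z [h1 h2 h3]]] := nd i (wo_max lt (wo_max lt a' a) (c i)) w.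
  have m1' := letr (maxl _ _) h1.
  have wz : agree lt a w z.
    by apply: agle h2 => //; apply: letr (maxl _ _) => //; exact: maxr.
  exists a'', z; split=> //.
  + exact: letr (maxl _ _) m1'.
  + apply: agree_trans yw _; apply: agle h2 => //.
    by apply: letr (maxl _ _) => //; exact: maxl.
  + by move=> p pa _; rewrite xw// wz.
  + exact: letr (maxr _ _) h1.
exists y.
  move=> p pa; have [i ai] := c_cof a; have [a' [ia' H _]] := yP i.
  by apply: H => //; apply: lttr pa _ => //; exact: ltle ia'.
by move=> [i _ Aiy]; have [a' [_ _ /(_ y)]] := yP i; apply.
Qed.

End Coding.

(** * Codes for bounded sequences *)

Section Codes.
Variables (L : Type) (lt : L -> L -> Prop) (wo : strict_wellorder lt).
Variables (M : Type) (iota : L -> M) (iota_inj : injective iota).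
Variables (N : Type) (phi : N -> seq_lt lt M) (phi_inj : injective phi).
Hypothesis room : forall a d : L, exists b,
  segment lt d #<= [set p | lt a p /\ lt p b] /\ lt a b.

(* Starting from position a, the sequence (d, sigma) is stored by writing d at
   a and the values of sigma at distinct positions between a and some b. *)
Lemma block_code_exists : exists (code : L -> N -> (L -> M) -> Prop) (b : L -> N -> L),
  [/\ forall a n, lt a (b a n),
      forall a n x y, code a n x -> agree lt (b a n) x y -> code a n y,
      forall a n n' x, code a n x -> code a n' x -> n = n' &
      forall a n x, exists y, agree lt a x y /\ code a n y].
Proof.
have /choice[bh bhP] : forall p : L * L, exists q : L * (L -> L), [/\ lt p.1 q.1,
    forall xi, lt xi p.2 -> lt p.1 (q.2 xi) /\ lt (q.2 xi) q.1 &
    forall xi xi', lt xi p.2 -> lt xi' p.2 -> q.2 xi = q.2 xi' -> xi = xi'].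
  move=> [a d] /=; have [b [/card_le_relP[R [Rtot Rinj]] ab]] := room a d.
  have /choice[h hP] xi : exists z, lt xi d -> (lt a z /\ lt z b) /\ R xi z.
    have [/Rtot[z ? ?]|nd] := EM (lt xi d); last by exists xi.
    by exists z.
  exists (b, h); split=> // [xi /hP[]//|xi xi' xd xd' /= e].
  have [_ R1] := hP _ xd; have [_ R2] := hP _ xd'.
  by apply: Rinj R1 _ => //; rewrite e.
pose h a d := (bh (a, d)).2.
(* The value at [a] reveals the length, and the length alone fixes where the entries are read; hence
   codes are unique. *)
exists (fun a n x => x a = iota (projT1 (phi n)) /\
  forall xi : {p | lt p (projT1 (phi n))},
    x (h a (projT1 (phi n)) (sval xi)) = projT2 (phi n) xi).
exists (fun a n => (bh (a, projT1 (phi n))).1); split.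
- by move=> a n; have [] := bhP (a, projT1 (phi n)).
- move=> a n x y [xa xh] xy; have [ab hb _] := bhP (a, projT1 (phi n)).
  split=> [|xi]; first by rewrite -xy.
  by rewrite -xy ?xh//; have [] := hb _ (svalP xi).
- move=> a n n' x [xa xh] [xa' xh']; apply: phi_inj.
  case: (phi n) (phi n') xa xh xa' xh' => [d u] [d' u'] /= -> xh /iota_inj.
  move=> dd; case: _ / dd u' => u' xh'.
  by congr existT; apply/funext => xi; rewrite -xh xh'.
- move=> a n x; have [/= ab hb hinj] := bhP (a, projT1 (phi n)).
  have /choice[y yP] p : exists m, [/\ lt p a -> x p = m,
      p = a -> m = iota (projT1 (phi n)) &
      forall xi : {q | lt q (projT1 (phi n))},
        p = h a (projT1 (phi n)) (sval xi) -> m = projT2 (phi n) xi].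
    case: (wo) => irr tr tot _; have [pa|[->|ap]] := tot p a.
    + exists (x p); split=> // [pe|xi pe]; exfalso.
        by apply: (irr a); rewrite -{1}pe.
      have [h1 _] := hb _ (svalP xi); apply: (irr p); apply: tr pa _.
      by rewrite pe.
    + exists (iota (projT1 (phi n))); split=> // [/irr//|xi ae]; exfalso.
      by have [h1 _] := hb _ (svalP xi); apply: (irr a); rewrite {2}ae.
    + have [[xi pe]|nxi] := EM (exists xi : {q | lt q (projT1 (phi n))},
          p = h a (projT1 (phi n)) (sval xi)).
        exists (projT2 (phi n) xi); split=> [pa|pe'|xi' pe'].
        * by case: (irr a); exact: tr ap pa.
        * by rewrite pe' in ap; case: (irr a).
        * suff -> : xi = xi' by []; apply: eq_sig_hprop => [q|]; first exact: Prop_irrelevance.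
          by apply: hinj (svalP xi) (svalP xi') _; exact: etrans (esym pe) pe'.
      exists (x p); split=> // [pe|xi pe]; exfalso.
        by rewrite pe in ap; exact: irr ap.
      by apply: nxi; exists xi.
  exists y; split=> [p pa|]; first by have [->] := yP p.
  split=> [|xi]; first by have [_ ->] := yP a.
  by have [_ _ yh] := yP (h a (projT1 (phi n)) (sval xi)); exact: yh.
Qed.

End Codes.

(** * Consequences of cofinality kappa, and room for codes *)

Section Cofinality.
Variables (K : Type) (ltK : K -> K -> Prop) (regK : regular_infinite_cardinal ltK).
Variables (L : Type) (lt : L -> L -> Prop) (wo : strict_wellorder lt).
Local Notation le := (le_of lt).
Hypothesis cfL : cofinality_is lt [set: K].

(** A largest element would form a cofinal singleton, but kappa is infinite. *)
Lemma cf_unbounded_gt a : exists b, lt a b.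
Proof.
have [_ Kinf _] := regK; apply: contrapT => na; apply: Kinf.
apply: card_le_finite (finite_set1 a); apply: (proj2 cfL) => d.
exists a => //; have [[->|da]|ad] := wo_leVlt wo d a; [by left|by right|].
by exfalso; apply: na; exists d.
Qed.

Lemma cf_succ : exists s : L -> L, (forall a, lt a (s a)) /\
  forall a p, lt p (s a) -> le p a.
Proof.
have /choice[s sP] a : exists u, lt a u /\ forall y, lt a y -> le u y.
  exact: wo_least (cf_unbounded_gt a).
exists s; split=> [a|a p ps]; first by have [] := sP a.
by apply/(wo_leNgt wo) => /(proj2 (sP a))/(wo_leNgt wo).
Qed.

(** An unbounded image would be cofinal, although it is no larger than a proper initial segment of
    kappa. *)
Lemma cf_bounded (i : K) (h : K -> L) : exists a, forall j, ltK j i -> le (h j) a.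
Proof.
have [[_ /(_ i)[_ nK]] _ _] := regK; apply: contrapT => nb; apply: nK.
apply: card_le_trans (card_image_le h _); apply: (proj2 cfL) => a.
apply: contrapT => na; apply: nb; exists a => j ji.
have [//|ah] := wo_leVlt wo (h j) a.
by exfalso; apply: na; exists (h j); [exists j|right].
Qed.

Lemma cf_monotone_cofinal : L -> exists c : K -> L,
  (forall a, exists i, lt a (c i)) /\ forall i j, ltK i j -> le (c i) (c j).
Proof.
move=> l0; have [[woK _] _ _] := regK; have [_ trK _ _] := woK.
have [[S Scof /card_eqPle[/card_le_relP[R [Rtot Rinj]] _]] _] := cfL.
have /choice[c0 c0P] k : exists x, forall y, S y -> R y k -> x = y.
  have [[y [Sy Ryk]]|ny] := EM (exists y, S y /\ R y k).
    by exists y => y' Sy' Ry'k; exact: Rinj Ryk Ry'k.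
  by exists l0 => y Sy Ryk; exfalso; apply: ny; exists y.
(* Running least upper bounds of [c0] give monotonicity. *)
have /choice[c cP] i : exists u, (forall j, le_of ltK j i -> le (c0 j) u) /\
    forall v, (forall j, le_of ltK j i -> le (c0 j) v) -> le u v.
  have [a aP] := cf_bounded i c0; apply: wo_least => //.
  exists (wo_max lt a (c0 i)) => j [->|ji]; first exact: wo_maxr.
  by apply: wo_le_trans (aP _ ji) _ => //; exact: wo_maxl.
exists c; split=> [a|i j ij].
  have [a' aa'] := cf_unbounded_gt a; have [y Sy ya'] := Scof a'.
  have [k _ Ryk] := Rtot _ Sy; exists k; apply: (wo_lt_le wo aa').
  apply: wo_le_trans (proj1 (cP k) k _) => //; last by left.
  by rewrite (c0P _ _ Sy Ryk); case: ya' => [->|]; [left|right].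
apply: (proj2 (cP i)) => k ki; apply: (proj1 (cP j)); right.
by case: ki => [->//|ki]; exact: trK ij.
Qed.

Lemma card_above a : is_cardinal lt -> infinite_set [set: L] ->
  [set: L] #<= [set p | lt a p].
Proof.
move=> [_ cardL] Linf; have [s [s_gt s_le]] := cf_succ.
have [|sL|//] := card_cover_infinite (A := segment lt (s a)) (B := [set p | lt a p]) Linf.
  move=> x; have [xa|] := wo_leVlt wo x a; [left|by right].
  exact: (wo_le_lt wo xa).
by exfalso; have [_] := cardL (s a); apply.
Qed.

End Cofinality.

Lemma regular_cofinality K (ltK : K -> K -> Prop) :
  regular_infinite_cardinal ltK -> cofinality_is ltK [set: K].
Proof.
move=> [_ _ reg]; split=> //; exists [set: K]; last exact: card_eqxx.
by move=> a; exists a => //; left.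
Qed.

Lemma regular_bounded K (ltK : K -> K -> Prop) (S : set K) :
  regular_infinite_cardinal ltK -> ~ ([set: K] #<= S) ->
  exists a, forall x, S x -> ltK x a.
Proof.
move=> [[wo _] _ reg] nS; apply: contrapT => nb; apply: nS; apply: reg => a.
apply: contrapT => na; apply: nb; exists a => x Sx.
apply/(wo_ltNge wo) => ax; apply: na; exists x => //.
by case: ax => [->|]; [left|right].
Qed.

(** Kappa many positions lie above [a]; a copy of the segment of [d] among them is too small to be
    cofinal. *)
Lemma regular_room K (ltK : K -> K -> Prop) : regular_infinite_cardinal ltK ->
  forall a d : K, exists b,
  segment ltK d #<= [set p | ltK a p /\ ltK p b] /\ ltK a b.
Proof.
move=> reg a d; have [[wo cardK] Kinf _] := reg; have cf := regular_cofinality reg.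
have /card_le_relP[R [Rtot Rinj]] := card_above reg wo cf a (conj wo cardK) Kinf.
have /choice[h hP] x : exists y, ltK a y /\ R x y.
  by have [y ? ?] := Rtot x I; exists y.
have [b bP] : exists b, forall x, (h @` segment ltK d) x -> ltK x b.
  apply: regular_bounded reg _ => Kd; have [_] := cardK d; apply.
  exact: card_le_trans Kd (card_image_le _ _).
have [a' aa'] := cf_unbounded_gt reg wo cf a.
exists (wo_max ltK b a'); split; last exact: wo_lt_le (wo_maxr wo _ _).
apply/card_le_relP; exists (fun x y => y = h x); split=> [x xd|x x' y _ _ -> e].
  exists (h x) => //; split; first by have [] := hP x.
  by apply: (wo_lt_le wo _ (wo_maxl _ _ _)); apply: bP; exists x.
by have [_ h1] := hP x; have [_ h2] := hP x'; apply: Rinj h1 _ => //; rewrite e.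
Qed.

(** Otherwise each interval from [a] to [c k] has at most |d| points, and their union, a final
    segment of size mu, has at most kappa * |d| < mu points. *)
Lemma singular_room K (ltK : K -> K -> Prop) M (ltM : M -> M -> Prop) :
  regular_infinite_cardinal ltK -> singular_cardinal_cf ltM K ->
  forall a d : M, exists b,
  segment ltM d #<= [set p | ltM a p /\ ltM p b] /\ ltM a b.
Proof.
move=> reg [[wo cardM] Minf cf [KM nMK]] a d.
have [_ Kinf _] := reg.
have [c [c_cof c_mono]] := cf_monotone_cofinal reg wo cf a.
suff [b h] : exists b, segment ltM d #<= [set p | ltM a p /\ ltM p b].
  have [a' aa'] := cf_unbounded_gt reg wo cf a.
  exists (wo_max ltM b a'); split; last exact: wo_lt_le (wo_maxr wo _ _).
  apply: card_le_trans h _; apply: subset_card_le => p [h1 h2]; split=> //.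
  exact: (wo_lt_le wo h2 (wo_maxl _ _ _)).
apply: contrapT => nb.
have /choice[R RP] k : exists R : M -> M -> Prop,
    (forall x, ltM a x /\ ltM x (c k) -> exists2 y, segment ltM d y & R x y) /\
    (forall x x' y, ltM a x /\ ltM x (c k) -> ltM a x' /\ ltM x' (c k) ->
       R x y -> R x' y -> x = x').
  apply/(card_le_relP [set p | ltM a p /\ ltM p (c k)]).
  have [h|//] := card_le_total (segment ltM d) [set p | ltM a p /\ ltM p (c k)].
  by exfalso; apply: nb; exists (c k).
have MKd : [set: M] #<= [set: K] `*` segment ltM d.
  apply: card_le_trans (card_above reg wo cf a (conj wo cardM) Minf) _.
  apply/card_le_relP; exists (fun x q => ltM x (c q.1) /\ R q.1 x q.2); split.
    move=> x ax; have [k xk] := c_cof x.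
    by have [y dy Ry] := proj1 (RP k) x (conj ax xk); exists (k, y).
  move=> x x' [k y] ax ax' [/= xk Rx] [x'k Rx'].
  exact: (proj2 (RP k)) (conj ax xk) (conj ax' x'k) Rx Rx'.
have [dM nMd] := cardM d.
have [Kd|dK] := card_le_total [set: K] (segment ltM d).
  apply: nMd; apply: card_le_trans MKd _.
  apply: card_le_trans (card_le_setX Kd (card_lexx _)) (card_setX_infinite _).
  by move=> dfin; apply: Kinf; exact: card_le_finite Kd dfin.
apply: nMK; apply: card_le_trans MKd _.
exact: card_le_trans (card_le_setX (card_lexx _) dK) (card_setX_infinite Kinf).
Qed.

(** * From cofinal families of meagre sets to dominating families *)

Section Topology.
Variables (L : Type) (lt : L -> L -> Prop) (wo : strict_wellorder lt).
Variables (M : Type) (B : set (set (L -> M))).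
Hypothesis B_cyl : forall C x, B C -> C x -> exists a, cyl (segment lt a) x `<=` C.
Hypothesis cyl_B : forall a x, B (cyl (segment lt a) x).

Lemma open_cyl a x : open_b B (cyl (segment lt a) x).
Proof. by move=> y xy; exists (cyl (segment lt a) x); [exact: cyl_B|split]. Qed.

(** Cylinders over initial segments are basic and refine every basic set around each of its points,
    so density can be tested on them. *)
Lemma nowhere_dense_cyl A : nowhere_dense_b B A <-> comb_nowhere_dense lt A.
Proof.
split=> [nd a x|nd].
  have [y xy ny] : exists2 y, agree lt a x y & ~ closure_b B A y.
    apply: contrapT => ny; rewrite -[False]/(set0 x) -nd.
    exists (cyl (segment lt a) x); first exact: open_cyl.
    split=> // z xz; apply: contrapT => nz; apply: ny; exists z => // p pa.
    by rewrite xz.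
  have /existsNP[U /not_implyP[Uo /not_implyP[Uy nUA]]] := ny.
  have [C BC [Cy CU]] := Uo _ Uy; have [a' a'C] := B_cyl BC Cy.
  exists (wo_max lt a a'), y; split=> //; first exact: wo_maxl.
  move=> z yz Az; apply: nUA; exists z; split=> //; apply/CU/a'C => p pa'.
  by rewrite yz//; exact: wo_lt_le (wo_maxr wo _ _).
rewrite /nowhere_dense_b -subset0 => x [U Uo [Ux UA]].
have [C BC [Cx CU]] := Uo _ Ux; have [a aC] := B_cyl BC Cx.
have [a' [x' [_ xx' nA]]] := nd a x.
have /UA/(_ _ (@open_cyl a' x')) : U x' by apply/CU/aC => p pa; rewrite xx'.
by case=> // z [x'z /nA]; apply=> p pa'; rewrite x'z.
Qed.

Variables (K : Type) (ltK : K -> K -> Prop) (regK : regular_infinite_cardinal ltK).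
Hypothesis cfL : cofinality_is lt [set: K].
Variables (iota : L -> M) (iota_inj : injective iota) (l0 : L).
Hypothesis room : forall a d : L, exists b,
  segment lt d #<= [set p | lt a p /\ lt p b] /\ lt a b.
Variables (N : Type) (Nseq : [set: N] #= [set: seq_lt lt M]).
Variables (F : set (set (L -> M))) (Fcof : cofinal_family (@meagre_b _ B K) F).

(** Common to both statements: [L] is kappa with the box base, or mu with the bounded base. *)
Theorem dominating_le_cofinal_meagre :
  exists2 D : set (N -> K), dominating ltK D & D #<= F.
Proof.
have [[woK _] Kinf _] := regK.
have [k0 _] := infinite_setN0 Kinf.
have [l1 l01] := cf_unbounded_gt regK wo cfL l0.
pose m0 := iota l0; pose m1 := iota l1.
have m01 : m0 <> m1 by move=> /iota_inj e; apply: (wo_irr wo (a := l0)); rewrite {2}e.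
have [s [s_gt s_le]] := cf_succ regK wo cfL.
have [c [c_cof c_mono]] := cf_monotone_cofinal regK wo cfL l0.
have bounded := cf_bounded regK wo cfL.
have /card_eqPle[NQ QN] := Nseq; have [phi phi_inj] := card_leTTP NQ.
have [code [b [b_gt code_loc code_uniq code_ex]]] :=
  block_code_exists wo iota_inj phi_inj room.
have nd_meagre A : comb_nowhere_dense lt A -> meagre_b B K A.
  move=> nd; exists (fun=> A); split=> [_|]; first exact/nowhere_dense_cyl.
  by apply/seteqP; split=> [x Ax|x [_ _ //]]; exists k0.
have /choice[AJ AJP] (J : set (L -> M)) : exists A : K -> set (L -> M), F J ->
    (forall i, comb_nowhere_dense lt (A i)) /\ J = \bigcup_i A i.
  have [/(proj1 Fcof)[A [And JA]]|nF] := EM (F J); last by exists (fun=> set0).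
  by exists A => _; split=> // i; apply/nowhere_dense_cyl.
have [psi psi_inj] := card_leTTP QN.
pose n0 := psi (existT _ l0 (fun=> m0)).
have NF : [set: N] #<= F.
  have [/card_le_relP[R [Rtot Rinj]]|//] := card_le_total F [set: N]; exfalso.
  have /choice[nJ nJP] (J : set (L -> M)) : exists n, F J -> R J n.
    have [/Rtot[n _ ?]|nF] := EM (F J); first by exists n.
    by exists n0.
  (* The Baire argument provides a point outside [J] in the cylinder of the code of [J]. *)
  have /choice[xJ xJP] (J : set (L -> M)) :
      exists x, F J -> code l0 (nJ J) x /\ ~ J x.
    have [FJ|nF] := EM (F J); last by exists (fun=> m0).
    have [y [_ cy]] := code_ex l0 (nJ J) (fun=> m0).
    have [nd JE] := AJP _ FJ.
    have [z yz nz] := baire_cylinder woK wo c_cof bounded m0 l0 (b l0 (nJ J)) y nd.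
    by exists z => _; rewrite {2}JE; split=> //; exact: code_loc cy _.
  have /nd_meagre/(proj2 Fcof)[J FJ JE] :
      comb_nowhere_dense lt [set x | exists2 J, F J & x = xJ J]; last first.
    by have [_] := xJP _ FJ; apply; apply: JE; exists J.
  move=> a x.
  have [[J [FJ xxJ]]|nJx] := EM (exists J, F J /\ agree lt a x (xJ J)); last first.
    exists a, x; split=> //; first exact: wo_refl.
    by move=> y xy [J FJ yE]; apply: nJx; exists J; rewrite -yE.
  (* Different members of [F] have different codes, so changing one value of [xJ J] beyond its code
     leads away from all the chosen points. *)
  have [m mJ] : exists m, m <> xJ J (wo_max lt a (b l0 (nJ J))).
    have [e|] := EM (m0 = xJ J (wo_max lt a (b l0 (nJ J)))); last by exists m0.
    by exists m1 => e'; apply: m01; rewrite e -e'.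
  have [z [xz zm]] := agree_glue wo (wo_max lt a (b l0 (nJ J))) (xJ J) (fun=> m).
  exists (s (wo_max lt a (b l0 (nJ J)))), z; split.
  - by right; apply: (wo_le_lt wo (wo_maxl _ _ _) (s_gt _)).
  - by apply: agree_trans xxJ _; apply: agree_le xz => //; exact: wo_maxl.
  move=> y zy [J' FJ' yE]; apply: mJ.
  have [cJ _] := xJP _ FJ; have [cJ' _] := xJP _ FJ'.
  have cy : code l0 (nJ J) (xJ J').
    rewrite -yE; apply: code_loc cJ _.
    apply: (agree_le wo (wo_maxr wo a _)); apply: agree_trans xz _.
    by apply: agree_le zy => //; right.
  have e := code_uniq _ _ _ _ cy cJ'.
  have JJ : J = J'.
    by apply: Rinj (nJP _ FJ) _ => //; rewrite e; exact: nJP.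
  by rewrite JJ -yE -zy -JJ ?zm//; left.
(* Padding by [m0] turns [t] into a point; [bound_spec] depends only on its values below the length
   of [t]. *)
pose ext (t : seq_lt lt M) p := if pselect (lt p (projT1 t)) is left h
  then projT2 t (exist _ p h) else m0.
have /choice[g gP] : forall q : set (L -> M) * K * seq_lt lt M * N, exists k,
    F q.1.1.1 ->
    bound_spec lt c code b (AJ q.1.1.1) q.1.1.2 (projT1 q.1.2) (ext q.1.2) q.2 k.
  move=> [[[J i] t] n] /=; have [FJ|nF] := EM (F J); last by exists k0.
  have [nd _] := AJP _ FJ.
  have [k kP] := bound_spec_ex wo c_cof b_gt code_loc code_ex (projT1 t) (ext t) n (nd i).
  by exists k.
exists [set d | exists J i t, F J /\ d = fun n => g (J, i, t, n)].
  move=> f; have [J FJ fJ] := proj2 Fcof _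
    (nd_meagre _ (coded_set_nowhere_dense wo c m01 b_gt code_loc code_uniq
      code_ex s_gt f)).
  have [_ JE] := AJP _ FJ; rewrite JE in fJ.
  pose restr a (x : L -> M) : seq_lt lt M := existT _ a (fun p => x (sval p)).
  have [|i [a [x fg]]] := coded_set_decode woK wo c_cof c_mono bounded l0 b_gt
      code_loc code_uniq s_gt s_le (g := fun i a x n => g (J, i, restr a x, n)) _ fJ.
    move=> i a x n; apply: bound_spec_agree (gP (J, i, restr a x, n) FJ) => /= p pa.
    by rewrite /ext /=; case: pselect.
  by exists (fun n => g (J, i, restr a x, n)) => //; exists J, i, (restr a x).
(* Since kappa <= |L| <= nu <= |F|, the triples (J, i, t) number at most |F|. *)
have QF : [set: seq_lt lt M] #<= F by exact: card_le_trans QN NF.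
have LQ : [set: L] #<= [set: seq_lt lt M].
  apply: (card_leTT_inj (f := fun a => existT _ a (fun=> m0) : seq_lt lt M)).
  by move=> a a' [].
have KF : [set: K] #<= F.
  apply: card_le_trans QF; apply: card_le_trans LQ.
  have [[S _ /card_eqPle[_ KS]] _] := cfL; exact: card_le_trans KS (card_leT _).
have FF : F `*` F #<= F.
  by apply: card_setX_infinite => Ffin; apply: Kinf; exact: card_le_finite KF Ffin.
apply: card_le_trans (FF).
apply: card_le_trans (card_le_setX (card_lexx F)
  (card_le_trans (card_le_setX KF QF) FF)).
apply/card_le_relP.
exists (fun d q => d = fun n => g (q.1, q.2.1, q.2.2, n)); split.
  by move=> d [J [i [t [FJ ->]]]]; exists (J, (i, t)).
by move=> d d' q _ _ -> ->.
Qed.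

End Topology.

(** * The two spaces of the theorem *)

(** By regularity, a domain of size below kappa is bounded in kappa. *)
Lemma box_base_cyl K (ltK : K -> K -> Prop) M C (x : K -> M) :
  regular_infinite_cardinal ltK -> @box_base K M C -> C x ->
  exists a, cyl (segment ltK a) x `<=` C.
Proof.
move=> reg [D [s [[_ nKD] ->]]] sx; have [a aD] := regular_bounded reg nKD.
by exists a => y xy p Dp; rewrite xy ?sx//; exact: aD.
Qed.


(* d(^nu kappa, <=_all) <= cof(I) is stated as: every cofinal family F of I
   admits a dominating family D with |D| <= |F|. *)
Theorem mainTheorem18 (K : Type) (ltK : K -> K -> Prop)
    (M : Type) (ltM : M -> M -> Prop) :
  regular_infinite_cardinal ltK ->
  singular_cardinal_cf ltM K ->
  (* (1) nu = mu^{<kappa} *)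
  (forall (N : Type), [set: N] #= [set: seq_lt ltK M] ->
     forall F : set (set (K -> M)),
       cofinal_family (@meagre_b (K -> M) (@box_base K M) K) F ->
       exists2 D : set (N -> K), dominating ltK D & D #<= F) /\
  (* (2) nu = mu^{<mu} *)
  (forall (N : Type), [set: N] #= [set: seq_lt ltM M] ->
     forall F : set (set (M -> M)),
       cofinal_family (@meagre_b (M -> M) (@bd_base M ltM) K) F ->
       exists2 D : set (N -> K), dominating ltK D & D #<= F).
Proof.
move=> reg sing; have [[woK cardK] Kinf _] := reg.
(* In (1) lengths below kappa are written as elements of mu through [iota]; in (2) the identity
   serves. *)
have [[woM _] Minf cf [/card_leTTP[iota iota_inj] _]] := sing.
split=> N Nseq F Fcof.
  have [k0 _] := infinite_setN0 Kinf.
  apply: (dominating_le_cofinal_meagre woK _ _ reg (regular_cofinality reg)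
    iota_inj k0 (regular_room reg) Nseq Fcof).
    by move=> C x; exact: box_base_cyl.
  by move=> a x; exists (segment ltK a), x.
have [l0 _] := infinite_setN0 Minf.
apply: (dominating_le_cofinal_meagre woM _ _ reg cf (iota := id) _ l0
  (singular_room reg sing) Nseq Fcof) => //.
  by move=> _ x [a [s ->]] sx; exists a => y xy p pa; rewrite xy ?sx.
by move=> a x; exists a, x.
Qed.
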